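(* For all real $x\ge 2$, \[ \sum_{N\le x} K^*(N) = x + O\Big(\frac{x}{\log x}\Big) \qquad\text{and}\qquad \sum_{\substack{N\le x\\ N\text{ odd}}} K^*(N) = \frac{x}{3} + O\Big(\frac{x}{\log x}\Big), \] where the sums run over positive integers $N$ and the implied constants are absolute.
   Context: Throughout, $p$ denotes a prime. For a positive integer $N$, $\nu_p(N)$ is the exponent of $p$ in $N$, $\phi$ is Euler's totient function, and $\left(\frac{a}{p}\right)$ is the Kronecker (Legendre) symbol, so that $\left(\frac{N-1}{p}\right)^2$ equals $0$ if $p\mid N-1$ and $1$ otherwise. Define \[ K(N) = \prod_{p\nmid N}\bigg(1-\frac{\left(\frac{N-1}{p}\right)^2 p+1}{(p-1)^2(p+1)}\bigg)\prod_{p\mid N}\bigg(1-\frac{1}{p^{\nu_p(N)}(p-1)}\bigg), \qquad K^*(N)=K(N)\frac{N}{\phi(N)}. \] *)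

(* Defs.v *)
From mathcomp Require Import all_boot all_order all_algebra.
From mathcomp Require Import all_classical all_reals all_analysis.

Set Implicit Arguments.
Unset Strict Implicit.
Unset Printing Implicit Defensive.

Import Order.TTheory GRing.Theory Num.Theory.
Import numFieldNormedType.Exports.

Local Open Scope classical_set_scope.
Local Open Scope ring_scope.

(* Meaningful for prime p only: the Legendre symbol for odd p, extended to
   p = 2 by Kronecker's convention. *)
Definition kronecker (a : int) (p : nat) : int :=
  if (p%:Z %| a)%Z then 0
  else if p == 2%N then
    if ((a == 1 %[mod 8])%Z || (a == 7 %[mod 8])%Z) then 1 else -1
  else if [exists b : 'I_p, (b%:Z ^+ 2 == a %[mod p%:Z])%Z] then 1 else -1.

Definition K_ndvd_factor (R : realType) (N p : nat) : R :=
  1 - ((kronecker (N%:Z - 1) p)%:~R ^+ 2 * p%:R + 1)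
      / ((p%:R - 1) ^+ 2 * (p%:R + 1)).

Definition K_dvd_factor (R : realType) (N p : nat) : R :=
  1 - (p%:R ^+ logn p N * (p%:R - 1))^-1.

(* The product over p not dividing N is infinite; it converges absolutely,
   each factor being 1 + O(p^-2). *)
Definition K (R : realType) (N : nat) : R :=
  limn (fun n : nat =>
    \prod_(0 <= p < n | prime p && ~~ (p %| N)%N) K_ndvd_factor R N p)
  * \prod_(p <- primes N) K_dvd_factor R N p.

Definition Kstar (R : realType) (N : nat) : R :=
  K R N * (N%:R / (totient N)%:R).

(* Main.v *)
Require Import Defs.
From mathcomp Require Import all_boot all_order all_algebra.
From mathcomp Require Import all_classical all_reals all_analysis.
From mathcomp Require Import ring lra zify.

Import Order.TTheory GRing.Theory Num.Theory.
Import numFieldNormedType.Exports.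

Local Open Scope ring_scope.

(** [Kstar N] is a product over all primes [p] of local factors [f_p N], and
    [f_p N = u_p + \sum_(k >= 1, p^k %| N) 1 / phi (p^k) + b_p [N = 1 mod p]]
    with nonnegative coefficients, [f_p] having mean value 1.  Adding primes
    one at a time and splitting residue classes by the Chinese remainder
    theorem, the sum over [N <= X], [N = a mod m], of a finite product of
    local factors is [X / m] up to the product of the total masses
    [e_p = 1 + 1/p + O(1/p^2)] of the coefficients.  Over the primes
    [p <= X] this product is [O(X^(2/3))], by comparing [e_p^3] with
    [(p / (p - 2))^2] and telescoping over odd [p].  For [N <= X] the primes
    [p > X] change [Kstar N] by a factor between [1 - 1/X] and [1].  For odd
    [N] the factor at 2 is the constant [2/3], and one uses [m = 2]. *)

(** * Local factors and their coefficients *)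

(** The value of the local factor when [p] divides neither [N] nor [N - 1]. *)
Definition base_coef (R : realFieldType) (p : nat) : R :=
  1 - ((p%:R - 1) ^+ 2)^-1.

(* [1 / phi (p ^ k)] *)
Definition pow_coef (R : realFieldType) (p k : nat) : R :=
  p%:R / (p%:R - 1) * p%:R^-1 ^+ k.

(** The amount by which the local factor exceeds [base_coef] when [p] divides [N - 1]. *)
Definition pred_coef (R : realFieldType) (p : nat) : R :=
  p%:R / ((p%:R - 1) ^+ 2 * (p%:R + 1)).

(* The total mass [base_coef + \sum_(k >= 1) pow_coef k + pred_coef]. *)
Definition err_factor (R : realFieldType) (p : nat) : R :=
  p%:R ^+ 3 / ((p%:R - 1) ^+ 2 * (p%:R + 1)).

(** The extra [p / (p - 1)] is the contribution of [p] to [N / phi(N)]. *)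
Definition local_factor (R : realType) (N p : nat) : R :=
  if (p %| N)%N then K_dvd_factor R N p * (p%:R / (p%:R - 1))
  else K_ndvd_factor R N p.

Lemma prime_ge2 (R : numDomainType) (p : nat) : prime p -> 2 <= p%:R :> R.
Proof. by move=> pp; rewrite ler_nat prime_gt1. Qed.

Lemma base_coef_ge0 (R : realFieldType) (p : nat) :
  prime p -> 0 <= base_coef R p.
Proof.
move=> /(prime_ge2 R); rewrite /base_coef; set q := p%:R => q2.
rewrite subr_ge0 invf_le1 ?exprn_gt0 ?expr_ge1 //; lra.
Qed.

Lemma pow_coef_ge0 (R : realFieldType) (p k : nat) :
  prime p -> 0 <= pow_coef R p k.
Proof.
move=> /(prime_ge2 R); rewrite /pow_coef; set q := p%:R => q2.
by rewrite mulr_ge0 ?divr_ge0 ?exprn_ge0 ?invr_ge0 //; lra.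
Qed.

Lemma pred_coef_ge0 (R : realFieldType) (p : nat) :
  prime p -> 0 <= pred_coef R p.
Proof.
move=> /(prime_ge2 R); rewrite /pred_coef; set q := p%:R => q2.
by rewrite divr_ge0 ?mulr_ge0 ?exprn_ge0 //; lra.
Qed.

Lemma err_factor_ge1 (R : realFieldType) (p : nat) :
  prime p -> 1 <= err_factor R p.
Proof.
move=> /(prime_ge2 R); rewrite /err_factor; set q := p%:R => q2.
have d0 : 0 < (q - 1) ^+ 2 * (q + 1) by apply: mulr_gt0; nra.
by rewrite ler_pdivlMr // mul1r; nra.
Qed.

Lemma sum_pow_coef (R : realFieldType) (p L : nat) : prime p ->
  \sum_(0 <= k < L) pow_coef R p k.+1 =
    p%:R / (p%:R - 1) ^+ 2 * (1 - p%:R^-1 ^+ L).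
Proof.
move=> /(prime_ge2 R); rewrite /pow_coef; set q := p%:R => q2.
elim: L => [|L IH]; first by rewrite big_geq // expr0 subrr mulr0.
rewrite big_nat_recr //= IH (exprS _ L); move: (_ ^+ L) => t.
by field; rewrite subr_eq0; apply/andP; split; apply/eqP; lra.
Qed.

(** Multiples of [p ^ k.+1] have density [p^-1 ^+ k.+1], so this is the mean of the divisibility
    terms. *)
Lemma sum_pow_coef_div (R : realFieldType) (p L : nat) : prime p ->
  \sum_(0 <= k < L) pow_coef R p k.+1 * p%:R^-1 ^+ k.+1 =
    p%:R / ((p%:R - 1) ^+ 2 * (p%:R + 1)) * (1 - p%:R^-1 ^+ L * p%:R^-1 ^+ L).
Proof.
move=> /(prime_ge2 R); rewrite /pow_coef; set q := p%:R => q2.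
elim: L => [|L IH]; first by rewrite big_geq // expr0 mulr1 subrr mulr0.
rewrite big_nat_recr //= IH (exprS _ L); move: (_ ^+ L) => t.
field; rewrite subr_eq0; apply/and3P; split; apply/eqP; lra.
Qed.

Lemma kronecker_sqr (R : pzRingType) (a : int) (p : nat) :
  ((kronecker a p)%:~R : R) ^+ 2 = (~~ (p%:Z %| a)%Z)%:R.
Proof.
rewrite /kronecker; case: ifP => _ /=; first by rewrite expr0n.
by do 2 case: ifP => _; rewrite ?expr1n // ?mulrN1z ?sqrrN expr1n.
Qed.

Lemma dvdz_predn (N p : nat) : (p%:Z %| N%:Z - 1)%Z = (N == 1 %[mod p])%N.
Proof. by rewrite -eqz_mod_dvd !modz_nat. Qed.

Lemma sum_pow_coef_dvd (R : realFieldType) (p N L : nat) : prime p ->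
  (0 < N < p ^ L)%N ->
  \sum_(0 <= k < L) pow_coef R p k.+1 * (p ^ k.+1 %| N)%N%:R =
    \sum_(0 <= k < logn p N) pow_coef R p k.+1.
Proof.
move=> pp /andP[N0 NL].
have vL : (logn p N <= L)%N.
  rewrite -(leq_exp2l _ _ (prime_gt1 pp)).
  by rewrite (leq_trans _ (ltnW NL))// dvdn_leq// pfactor_dvdn.
rewrite (big_cat_nat (leq0n _) vL) /= -[RHS]addr0; congr (_ + _); last first.
  rewrite big_nat; apply: big1 => k /andP[vk _].
  by rewrite pfactor_dvdn // ltnNge vk mulr0.
apply: eq_big_nat => k /andP[_ kv].
by rewrite pfactor_dvdn // kv mulr1.
Qed.

(** A multiple of [p] is not 1 mod [p], so at most one kind of correction is active. If [p] divides
    [N], the geometric sum stops at [logn p N], which [N < p ^ L] keeps within range. *)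
Lemma local_factor_expansion (R : realType) (p N L : nat) : prime p ->
  (0 < N < p ^ L)%N ->
  local_factor R N p = base_coef R p
    + \sum_(0 <= k < L) pow_coef R p k.+1 * (p ^ k.+1 %| N)%N%:R
    + pred_coef R p * (N == 1 %[mod p])%N%:R.
Proof.
move=> pp NL; rewrite sum_pow_coef_dvd // sum_pow_coef //.
have /andP[N0 _] := NL; have p1 := prime_gt1 pp.
have := prime_ge2 R p pp; rewrite /local_factor /base_coef /pred_coef.
rewrite /K_dvd_factor /K_ndvd_factor kronecker_sqr dvdz_predn.
set q := p%:R => q2.
have [dN|ndN] := boolP (p %| N)%N.
  have -> : (N == 1 %[mod p])%N = false.
    by move: dN; rewrite /dvdn => /eqP ->; rewrite modn_small.
  rewrite exprVn mulr0.
  have qv : q ^+ logn p N != 0 by rewrite expf_neq0 //; apply/eqP; lra.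
  by field; rewrite qv /=; apply/eqP; lra.
rewrite lognE pp N0 (negbTE ndN) /= subrr mulr0 addr0.
by case: (_ == _) => /=; field; apply/andP; split; apply/eqP; lra.
Qed.

Lemma local_factor_ge0 (R : realType) (p N : nat) : prime p -> (0 < N)%N ->
  0 <= local_factor R N p.
Proof.
move=> pp N0; rewrite (@local_factor_expansion _ _ _ N) //; last first.
  by rewrite N0 ltn_expl // prime_gt1.
apply: addr_ge0; last by rewrite mulr_ge0 // pred_coef_ge0.
apply: addr_ge0; first exact: base_coef_ge0.
by apply: sumr_ge0 => k _; rewrite mulr_ge0 // pow_coef_ge0.
Qed.

(** * Sums of products of local factors over residue classes *)

Lemma count_residue_class (R : realFieldType) (m a X : nat) : (0 < m)%N ->
  `|\sum_(1 <= N < X.+1 | N == a %[mod m]) 1 - X%:R / m%:R| <= 1 :> R.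
Proof.
(* [a0.+1] represents [a] in [[1, m]], and the shift by [c = m - a0.+1] carries the class to the
   multiples of [m]. The count is thus [(X + c) %/ m], and both [c] and the remainder are below
   [m]. *)
move=> m0; pose a0 := ((a + m.-1) %% m)%N.
have a0m : (a0 < m)%N by rewrite ltn_mod.
have aE : (a0.+1 == a %[mod m])%N.
  by rewrite -addn1 modnDml -addnA addn1 prednK // modnDr.
pose c := (m.-1 - a0)%N.
have cE : (a0.+1 + c = m)%N by rewrite /c; lia.
have -> : \sum_(1 <= N < X.+1 | N == a %[mod m]) 1 = ((X + c) %/ m)%:R :> R.
  elim: X => [|X IH]; first by rewrite big_geq // divn_small // add0n /c; lia.
  rewrite big_mkcond big_nat_recr //= -big_mkcond IH addSn divnS // natrD addrC.
  congr (_ + _); rewrite -(eqP aE) -(eqn_modDr c) cE modnn addSn /dvdn.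
  by case: (_ == _).
have mR : 0 < m%:R :> R by rewrite ltr0n.
rewrite -(ler_pM2r mR) mul1r -{2}(gtr0_norm mR) -normrM mulrBl divfK ?gt_eqF //.
rewrite -natrM; have /(congr1 (fun n => n%:R : R)) := divn_eq (X + c) m.
rewrite !natrD; have : ((X + c) %% m)%:R <= m%:R :> R.
  by rewrite ler_nat ltnW // ltn_mod.
have : c%:R <= m%:R :> R by rewrite ler_nat /c; lia.
have := ler0n R c; have := ler0n R ((X + c) %% m).
by move=> ? ? ? ? ?; rewrite ler_norml; apply/andP; split; lra.
Qed.

Lemma residue_class_chinese (m n a b N : nat) : coprime m n ->
  (N == chinese m n a b %[mod m * n]) =
  (N == a %[mod m]) && (N == b %[mod n]).
Proof.
move=> mn; rewrite chinese_remainder //.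
by rewrite (chinese_modl mn) (chinese_modr mn).
Qed.

(** Expand the local factor and exchange the sums; each condition modulo a power of [p] merges with
    [N = a mod m] into one class. The cut-off [L = X] serves every [N <= X], as [X < p ^ X]. *)
Lemma sum_local_factor (R : realType) (F : nat -> R) (p m a X : nat) :
    prime p -> coprime m p ->
  \sum_(1 <= N < X.+1 | N == a %[mod m]) local_factor R N p * F N =
  base_coef R p * (\sum_(1 <= N < X.+1 | N == a %[mod m]) F N)
  + \sum_(0 <= k < X) pow_coef R p k.+1 *
      (\sum_(1 <= N < X.+1 | N == chinese m (p ^ k.+1) a 0 %[mod m * p ^ k.+1])
         F N)
  + pred_coef R p *
      (\sum_(1 <= N < X.+1 | N == chinese m p a 1 %[mod m * p]) F N).
Proof.
move=> pp mp; have p1 := prime_gt1 pp.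
have residue b (n j : nat) : coprime m n ->
    \sum_(1 <= N < X.+1 | N == chinese m n a b %[mod m * n]) F N =
    \sum_(1 <= N < X.+1 | N == a %[mod m]) (N == b %[mod n])%N%:R * F N.
  move=> mn; under eq_bigl do rewrite residue_class_chinese //.
  rewrite big_mkcondr /=; apply: eq_bigr => N _.
  by case: (_ == b %[mod n])%N; rewrite ?mul1r ?mul0r.
under [X in _ + X + _]eq_bigr do rewrite residue ?coprimeXr // big_distrr /=.
rewrite exchange_big_nat /= residue // !big_distrr /= -!big_split /=.
rewrite big_nat_cond [RHS]big_nat_cond; apply: eq_bigr => N.
case/andP=> /andP[N0 NX] _.
rewrite (@local_factor_expansion _ _ _ X) //; last first.
  by rewrite N0 (leq_ltn_trans _ (ltn_expl X p1)).
rewrite !mulrDl big_distrl mulrA /=; congr (_ + _ + _).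
by apply: eq_bigr => k _; rewrite mulrA mod0n.
Qed.

(** The subtracted tail is slack: it will pay for the truncation in [pow_coefs_mean]. *)
Lemma pow_coefs_sum (R : realFieldType) (p L : nat) : prime p ->
  base_coef R p + \sum_(0 <= k < L) pow_coef R p k.+1 + pred_coef R p =
  err_factor R p - p%:R / (p%:R - 1) ^+ 2 * p%:R^-1 ^+ L.
Proof.
move=> pp; rewrite sum_pow_coef //; have := prime_ge2 R p pp.
rewrite /base_coef /pred_coef /err_factor; set q := p%:R => q2.
by move: (_ ^+ L) => t; field; apply/andP; split; apply/eqP; lra.
Qed.

(* For [L] going to infinity: the local factor at [p] has mean value 1. *)
Lemma pow_coefs_mean (R : realFieldType) (p L : nat) : prime p ->
  base_coef R p + \sum_(0 <= k < L) pow_coef R p k.+1 * p%:R^-1 ^+ k.+1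
    + pred_coef R p * p%:R^-1 =
  1 - p%:R / ((p%:R - 1) ^+ 2 * (p%:R + 1)) * (p%:R^-1 ^+ L * p%:R^-1 ^+ L).
Proof.
move=> pp; rewrite sum_pow_coef_div //; have := prime_ge2 R p pp.
rewrite /base_coef /pred_coef; set q := p%:R => q2.
move: (_ ^+ L) => t; field.
by rewrite !subr_eq0; apply/and3P; split; apply/eqP; lra.
Qed.

(** The coefficients are nonnegative, so errors of size [E] in the classes add up to at most their
    mass times [E], while the main terms add up to [X / m] because the mean is 1. *)
Lemma sum_local_factor_mean (R : realType) (F : nat -> R) (p m a X : nat)
    (E : R) : prime p -> (0 < m)%N -> coprime m p -> 1 <= E ->
  (forall k b,
    `|\sum_(1 <= N < X.+1 | N == b %[mod m * p ^ k]) F N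
      - X%:R / (m * p ^ k)%:R| <= E) ->
  `|\sum_(1 <= N < X.+1 | N == a %[mod m]) local_factor R N p * F N
    - X%:R / m%:R| <= err_factor R p * E.
Proof.
move=> pp m0 mp E1 HF; rewrite sum_local_factor //.
pose S k b : R := \sum_(1 <= N < X.+1 | N == b %[mod m * p ^ k]) F N.
pose x : R := X%:R / m%:R; pose z : R := p%:R^-1.
have HS k b : `|S k b - x * z ^+ k| <= E.
  by rewrite /x /z exprVn -mulrA -invfM -natrX -natrM; apply: HF.
have E0 : 0 <= E by apply: le_trans E1.
have m1 : 1 <= m%:R :> R by rewrite ler1n.
have x0 : 0 <= x by rewrite divr_ge0.
have xX : x <= X%:R by rewrite ler_pdivrMr ?ltr0n // ler_peMr.
have -> : \sum_(1 <= N < X.+1 | N == a %[mod m]) F N = S 0 a.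
  by rewrite /S expn0 muln1.
set A := \sum_(0 <= k < X) _; set S1 := (X in pred_coef R p * X).
pose B := \sum_(0 <= k < X) pow_coef R p k.+1 * z ^+ k.+1.
pose W := \sum_(0 <= k < X) pow_coef R p k.+1.
have HA : `|A - x * B| <= W * E.
  rewrite /A /B /W big_distrr big_distrl -sumrB /=.
  apply: le_trans (ler_norm_sum _ _ _) _; apply: ler_sum => k _.
  rewrite mulrCA -mulrBr normrM ger0_norm ?pow_coef_ge0 //.
  by rewrite ler_wpM2l ?pow_coef_ge0 //; apply: HS.
have H0 : `|base_coef R p * (S 0 a - x)| <= base_coef R p * E.
  rewrite normrM ger0_norm ?base_coef_ge0 // ler_wpM2l ?base_coef_ge0 //.
  by have := HS 0%N a; rewrite mulr1.
have H1 : `|pred_coef R p * (S1 - x * z)| <= pred_coef R p * E.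
  rewrite normrM ger0_norm ?pred_coef_ge0 // ler_wpM2l ?pred_coef_ge0 //.
  exact: (HS 1%N).
have Hsum := pow_coefs_sum R p X pp; have Hmean := pow_coefs_mean R p X pp.
move: Hsum Hmean; rewrite -/z -/B -/W.
set c : R := p%:R / ((p%:R - 1) ^+ 2 * (p%:R + 1)).
set d : R := p%:R / (p%:R - 1) ^+ 2; set t := z ^+ X => Hsum Hmean.
have q2 : 2 <= p%:R :> R := prime_ge2 R p pp.
have t0 : 0 <= t by rewrite exprn_ge0 // invr_ge0.
have xt : x * t <= 1.
  apply: le_trans (ler_wpM2r t0 xX) _.
  rewrite /t /z exprVn ler_pdivrMr ?exprn_gt0 ?ltr0n ?prime_gt0 // mul1r.
  by rewrite -natrX ler_nat ltnW // ltn_expl // prime_gt1.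
have d0 : 0 <= d by rewrite divr_ge0 // exprn_ge0 // subr_ge0; lra.
have c0 : 0 <= c by apply: pred_coef_ge0.
have cd : c <= d by rewrite /c /d invfM mulrA ler_piMr // invf_le1; lra.
have tail0 : 0 <= x * (c * (t * t)).
  exact: mulr_ge0 x0 (mulr_ge0 c0 (mulr_ge0 t0 t0)).
(* Stopping at [k = X] loses a main term [x * c * t ^+ 2]; the slack [d * t] in the mass covers it,
   since [c <= d] and [x * t <= 1 <= E]. *)
have tail : x * (c * (t * t)) <= d * t * E.
  have -> : x * (c * (t * t)) = c * t * (x * t) by ring.
  apply: ler_pM; [exact: mulr_ge0 c0 t0|exact: mulr_ge0 x0 t0| |].
    exact: ler_wpM2r.
  exact: le_trans xt E1.
have -> : base_coef R p * S 0 a + A + pred_coef R p * S1 - X%:R / m%:R =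
   base_coef R p * (S 0 a - x) + (A - x * B) + pred_coef R p * (S1 - x * z)
   - x * (c * (t * t)).
  have -> : c * (t * t) = 1 - (base_coef R p + B + pred_coef R p * z).
    by rewrite Hmean; ring.
  by rewrite -/x; ring.
have -> : err_factor R p = base_coef R p + W + pred_coef R p + d * t.
  by rewrite Hsum; ring.
have -> : (base_coef R p + W + pred_coef R p + d * t) * E =
  base_coef R p * E + W * E + pred_coef R p * E + d * t * E by ring.
apply: le_trans (ler_normB _ _) _.
rewrite (ger0_norm tail0); apply: lerD => //.
apply: le_trans (ler_normD _ _) _; apply: lerD => //.
by apply: le_trans (ler_normD _ _) _; apply: lerD.
Qed.

(** Induction on [s] for all [m] and [a]: removing [p] calls for the moduli [m * p ^ k], which stay
    coprime to the remaining primes as [s] has no repetition. *)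
Lemma sum_prod_local_factor (R : realType) (s : seq nat) (m a X : nat) :
    uniq s -> all prime s -> (0 < m)%N -> all (coprime m) s ->
  `|\sum_(1 <= N < X.+1 | N == a %[mod m]) \prod_(p <- s) local_factor R N p
    - X%:R / m%:R| <= \prod_(p <- s) err_factor R p.
Proof.
elim: s m a => [|p s IH] m a /=.
  move=> _ _ m0 _; rewrite big_nil.
  under eq_bigr do rewrite big_nil; exact: count_residue_class.
case/andP=> ps us /andP[pp as_] m0 /andP[mp ms]; rewrite big_cons.
under eq_bigr do rewrite big_cons.
apply: sum_local_factor_mean => //.
  rewrite big_seq; elim/big_ind: _ => // [x y|q qs].
    by move=> x1 y1; rewrite mulr_ege1.
  by rewrite err_factor_ge1 // (allP as_).
move=> k b; apply: IH => //; first by rewrite muln_gt0 m0 expn_gt0 prime_gt0.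
apply/allP => q qs; rewrite coprimeMl (allP ms) //=; apply: coprimeXl.
have pq := allP as_ q qs; rewrite prime_coprime // dvdn_prime2 //.
by apply: contraNneq ps => ->.
Qed.

(** * Growth of the product of the total masses *)

(** To first order this compares [1 + 3/p] with [1 + 4/p]; the exact inequality is the product of
    [le1] and [le2]. *)
Lemma err_factor_cube (R : realFieldType) (p : nat) : (3 <= p)%N ->
  err_factor R p ^+ 3 <= (p%:R / (p%:R - 2)) ^+ 2.
Proof.
rewrite -(ler_nat R) /err_factor; set q := p%:R => q3.
rewrite !expr_div_n ler_pdivrMr; last first.
  by apply: exprn_gt0; apply: mulr_gt0; nra.
rewrite mulrAC ler_pdivlMr; last by apply: exprn_gt0; lra.
(* In the variable [t = q - 3] the difference in [le2] has only positive coefficients. *)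
have [t qE t0] : exists2 t, q = t + 3 & 0 <= t by exists (q - 3); [ring|lra].
have le1 : (q ^+ 2 - 2 * q) ^+ 2 <= (q - 1) ^+ 4.
  rewrite (_ : (q - 1) ^+ 4 = (q ^+ 2 - 2 * q + 1) ^+ 2); last by ring.
  by rewrite lerXn2r ?nnegrE; nra.
have le2 : q ^+ 5 <= (q - 1) ^+ 2 * (q + 1) ^+ 3.
  rewrite qE -subr_ge0.
  have -> : (t + 3 - 1) ^+ 2 * (t + 3 + 1) ^+ 3 - (t + 3) ^+ 5 =
    13 + 43 * t + 34 * t ^+ 2 + 10 * t ^+ 3 + t ^+ 4 by ring.
  by do !apply: addr_ge0; rewrite ?mulr_ge0 ?exprn_ge0.
have -> : q ^+ 3 ^+ 3 * (q - 2) ^+ 2 =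
  q ^+ 2 * ((q ^+ 2 - 2 * q) ^+ 2 * q ^+ 5) by ring.
have -> : q ^+ 2 * ((q - 1) ^+ 2 * (q + 1)) ^+ 3 =
  q ^+ 2 * ((q - 1) ^+ 4 * ((q - 1) ^+ 2 * (q + 1) ^+ 3)) by ring.
rewrite ler_wpM2l ?exprn_ge0 //.
by apply: ler_pM => //; rewrite exprn_ge0 //; nra.
Qed.

(** Each step of the induction adds the composite [2j + 4] and perhaps the prime [2j + 5], whose
    cubed mass is at most [((2j + 5) / (2j + 3)) ^ 2]. *)
Lemma prod_err_factor_cube_odd (R : realFieldType) (j : nat) :
  (\prod_(0 <= p < j.+2.*2 | prime p) err_factor R p) ^+ 3 <=
  11 * j.+1.*2.+1%:R ^+ 2.
Proof.
elim: j => [|j IH].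
  (* The constant 11 comes from [(8/3 * 27/16) ^ 3 = (9/2) ^ 3 <= 11 * 3 ^ 2]. *)
  rewrite (_ : 0.+2.*2 = 4)%N // big_mkcond !big_nat_recr //= big_geq // !mul1r.
  have -> : err_factor R 2 = 8 / 3 by rewrite /err_factor; field.
  have -> : err_factor R 3 = 27 / 16 by rewrite /err_factor; field.
  by rewrite (_ : 1.*2.+1 = 3)%N //; lra.
rewrite (_ : j.+3.*2 = j.+2.*2.+2)%N // big_mkcond 2?big_nat_recr //=.
rewrite -big_mkcond /= ifF; last first.
  by apply/negbTE/negP => /even_prime []; [lia|rewrite odd_double].
rewrite mulr1 exprMn.
case: ifP => pp; last first.
  rewrite expr1n mulr1 (le_trans IH) // ler_pM2l // lerXn2r ?nnegrE //.
  by rewrite ler_nat; lia.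
have c3 := @err_factor_cube R j.+2.*2.+1 isT.
have e0 : 0 <= err_factor R j.+2.*2.+1.
  by rewrite (le_trans ler01) // err_factor_ge1.
have P0 : 0 <= \prod_(0 <= p < j.+2.*2 | prime p) err_factor R p.
  by apply: prodr_ge0 => p /(err_factor_ge1 R); apply: le_trans.
apply: le_trans (ler_pM _ _ IH c3) _; rewrite ?exprn_ge0 //.
have -> : j.+2.*2.+1%:R - 2 = j.+1.*2.+1%:R :> R.
  by rewrite -(@natrB _ _ 2) //; congr (_%:R); lia.
have c0 : j.+1.*2.+1%:R != 0 :> R by rewrite pnatr_eq0.
by rewrite expr_div_n mulrACA divff ?expf_neq0 // mulr1.
Qed.

Lemma ler_prod_nat_widen (R : realFieldType) (F : nat -> R) (P : pred nat)
    (m n : nat) : (m <= n)%N -> (forall i, P i -> 1 <= F i) ->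
  \prod_(0 <= i < m | P i) F i <= \prod_(0 <= i < n | P i) F i.
Proof.
move=> mn F1; rewrite (big_cat_nat (leq0n m) mn) /= ler_peMr //.
  by apply: prodr_ge0 => i /F1; apply: le_trans.
by elim/big_ind: _ => // x y x1 y1; rewrite mulr_ege1.
Qed.

Lemma prod_err_factor_cube (R : realFieldType) (X : nat) : (2 <= X)%N ->
  (\prod_(0 <= p < X.+1 | prime p) err_factor R p) ^+ 3 <= 44 * X%:R ^+ 2.
Proof.
(* Here [2j + 4 >= X + 1] and [2j + 3 <= X + 2 <= 2X], whence [44 = 11 * 2 ^ 2]. *)
move=> X2; pose j := (X.-1)./2.
have jX : (X.+1 <= j.+2.*2)%N by rewrite /j; lia.
have jX' : (j.+1.*2.+1 <= 2 * X)%N by rewrite /j; lia.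
have e0 n : 0 <= \prod_(0 <= p < n | prime p) err_factor R p.
  by apply: prodr_ge0 => p /(err_factor_ge1 R); apply: le_trans.
apply: (@le_trans _ _ (11 * j.+1.*2.+1%:R ^+ 2)).
  apply: le_trans (prod_err_factor_cube_odd R j).
  rewrite lerXn2r ?nnegrE //; apply: ler_prod_nat_widen => // p.
  exact: err_factor_ge1.
have -> : 44 * X%:R ^+ 2 = 11 * (2 * X)%:R ^+ 2 :> R by rewrite natrM; ring.
by rewrite ler_pM2l // lerXn2r ?nnegrE // ler_nat.
Qed.

(** Cube [y <= expR y] at [y = ln x / 3]. This turns a bound of order [x^(2/3)] into one of order
    [x / ln x]. *)
Lemma ln_cube_le (R : realType) (x : R) : 1 <= x -> ln x ^+ 3 <= 27 * x.
Proof.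
move=> x1; have x0 : 0 < x by lra.
have l0 : 0 <= ln x by apply: ln_ge0.
have := expR_ge1Dx (ln x / 3) => h.
have : (ln x / 3) ^+ 3 <= expR (ln x / 3) ^+ 3.
  by rewrite lerXn2r ?nnegrE ?expR_ge0 //; lra.
rewrite -expRM_natl (_ : 3%:R * (ln x / 3) = ln x) ?lnK ?posrE //; last by lra.
by rewrite expr_div_n; lra.
Qed.

Lemma prod_err_factor_le (R : realType) (X : nat) (x : R) :
  2 <= x -> (2 <= X)%N -> X%:R <= x ->
  \prod_(0 <= p < X.+1 | prime p) err_factor R p <= 11 * (x / ln x).
Proof.
move=> x2 X2 Xx; set E := \prod_(_ <= p < _ | _) _.
have E0 : 0 <= E by apply: prodr_ge0 => p /(err_factor_ge1 R); apply: le_trans.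
have l0 : 0 < ln x by apply: ln_gt0; lra.
rewrite mulrA ler_pdivlMr // -(@ler_pXn2r _ 3) ?nnegrE //; last 2 first.
- by rewrite mulr_ge0 // ltW.
- by lra.
rewrite !exprMn; have Ec := prod_err_factor_cube R X X2; rewrite -/E in Ec.
have lc : ln x ^+ 3 <= 27 * x by apply: ln_cube_le; lra.
have X2x : X%:R ^+ 2 <= x ^+ 2 by rewrite lerXn2r ?nnegrE //; lra.
(* The cubes compare because [44 * 27 = 1188 <= 1331 = 11 ^ 3]. *)
apply: (@le_trans _ _ ((44 * x ^+ 2) * (27 * x))).
  apply: ler_pM => //; [exact: exprn_ge0|exact/exprn_ge0/ltW|].
  by apply: le_trans Ec _; rewrite ler_pM2l.
have : 0 <= x ^+ 3 by rewrite exprn_ge0 //; lra.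
lra.
Qed.

(** * Comparison of [Kstar] with a finite product *)

Lemma natr_div_totient (R : numFieldType) (N : nat) : (0 < N)%N ->
  N%:R / (totient N)%:R = \prod_(p <- primes N) (p%:R / (p%:R - 1)) :> R.
Proof.
move=> N0; rewrite totientE // {1}(prod_prime_decomp N0) prime_decompE big_map.
rewrite !natr_prod -prodf_div /= big_seq [RHS]big_seq.
apply: eq_bigr => p; rewrite mem_primes => /and3P[pp _ pN].
have v0 : (0 < logn p N)%N by rewrite logn_gt0 mem_primes pp N0.
have q0 : p%:R != 0 :> R by rewrite pnatr_eq0 -lt0n prime_gt0.
rewrite -{1}(prednK v0) expnS !natrM -[p.-1]subn1 natrB ?prime_gt0 //.
by rewrite -mulf_div divff ?mulr1 // pnatr_eq0 -lt0n expn_gt0 prime_gt0.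
Qed.

Lemma prod_primes (R : comPzSemiRingType) (F : nat -> R) (N n : nat) :
    (0 < N < n)%N ->
  \prod_(p <- primes N) F p = \prod_(0 <= p < n | prime p && (p %| N)%N) F p.
Proof.
case/andP=> N0 Nn; rewrite -[RHS]big_filter; apply: perm_big.
apply: uniq_perm; rewrite ?primes_uniq ?filter_uniq ?iota_uniq // => p.
rewrite mem_filter mem_primes mem_index_iota N0 /=.
case: (prime p) => //=; case: (boolP (p %| N)%N) => //= pN.
by rewrite (leq_ltn_trans _ Nn) // dvdn_leq.
Qed.

(** The squared symbol is 0 or 1, and the lower bound is the value at 1. Allowing every integer
    [k >= 2] lets a tail over primes be compared with a telescoping product over all integers. *)
Lemma K_ndvd_factor_bounds (R : realType) (N k : nat) : (2 <= k)%N ->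
  1 - ((k%:R - 1) ^+ 2)^-1 <= K_ndvd_factor R N k <= 1.
Proof.
rewrite -(ler_nat R) /K_ndvd_factor kronecker_sqr; set q := k%:R => q2.
set c := _%:R : R.
have /andP[c0 c1] : 0 <= c <= 1.
  by rewrite /c; case: (~~ _); rewrite ?lexx ?ler01.
have d0 : 0 < (q - 1) ^+ 2 * (q + 1) by apply: mulr_gt0; nra.
apply/andP; split; last by rewrite gerBl divr_ge0 ?ltW //; nra.
rewrite lerD2l lerN2 invfM mulrA ler_pdivrMr; last by lra.
rewrite mulrC ler_wpM2l ?invr_ge0 ?exprn_ge0 //; [lra|nra].
Qed.

(** The bounds are uniform in [d], so they survive the passage to the infinite product. *)
Lemma prod_K_ndvd_factor_tail (R : realType) (P : pred nat) (N X d : nat) :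
    (2 <= X)%N ->
  1 - X%:R^-1 <=
    \prod_(X.+1 <= p < (X.+1 + d) | P p) K_ndvd_factor R N p <= 1.
Proof.
move=> X2; have x2 : 2 <= X%:R :> R by rewrite ler_nat.
have bnd (k : nat) : (2 <= k)%N -> 0 <= K_ndvd_factor R N k <= 1.
  move=> k2; have /andP[h ->] := K_ndvd_factor_bounds R N k k2.
  rewrite andbT; apply: le_trans h; rewrite subr_ge0.
  move: k2; rewrite -(ler_nat R) => k2.
  by rewrite invf_le1 ?exprn_gt0 ?expr_ge1 //; lra.
apply/andP; split; last first.
  rewrite big_nat_cond; apply: prodr_ile1 => k /andP[/andP[Xk _] _].
  by apply: bnd; lia.
(* [1 - 1 / (k-1)^2 = (k / (k-1)) / ((k-1) / (k-2))] telescopes. *)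
have tele : (1 - X%:R^-1) * ((X + d)%:R / ((X + d)%:R - 1)) <=
    \prod_(X.+1 <= p < (X.+1 + d) | P p) K_ndvd_factor R N p.
  elim: d => [|d IH].
    rewrite !addn0 big_geq // (_ : _ * _ = 1) //.
    by field; apply/andP; split; apply/eqP; lra.
  rewrite big_mkcond (addnS X.+1 d) big_nat_recr ?leq_addr // -big_mkcond.
  set y : R := (X + d)%:R in IH.
  have y2 : 2 <= y by rewrite ler_nat; lia.
  have -> : (X + d.+1)%:R = y + 1 :> R by rewrite addnS -natr1.
  have -> : (1 - X%:R^-1) * ((y + 1) / (y + 1 - 1)) =
      (1 - X%:R^-1) * (y / (y - 1)) * (1 - (y ^+ 2)^-1) :> R.
    by field; apply/and3P; split; apply/eqP; lra.
  have b0 : 0 <= 1 - (y ^+ 2)^-1.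
    by rewrite subr_ge0 invf_le1 ?exprn_gt0 ?expr_ge1 //; lra.
  have a0 : 0 <= (1 - X%:R^-1) * (y / (y - 1)).
    rewrite mulr_ge0 ?divr_ge0 //; try lra.
    by rewrite subr_ge0 invf_le1; lra.
  apply: ler_pM => //; case: ifP => _.
    have k2 : (2 <= X.+1 + d)%N by lia.
    have /andP[h _] := K_ndvd_factor_bounds R N (X.+1 + d) k2.
    by apply: le_trans h; rewrite addSn -natr1 addrK.
  by rewrite gerBl invr_ge0 exprn_ge0 //; lra.
apply: le_trans tele; rewrite ler_peMr //.
  by rewrite subr_ge0 invf_le1; lra.
have y2 : 2 <= (X + d)%:R :> R by rewrite ler_nat; lia.
by rewrite ler_pdivlMr; lra.
Qed.

(** All primes dividing [N] are at most [X], so beyond [X] only factors [K_ndvd_factor] remain, and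
    the tail bound controls their limit. *)
Lemma Kstar_bounds (R : realType) (N X : nat) : (2 <= X)%N -> (0 < N <= X)%N ->
  (1 - X%:R^-1) * \prod_(0 <= p < X.+1 | prime p) local_factor R N p
    <= Kstar R N <= \prod_(0 <= p < X.+1 | prime p) local_factor R N p.
Proof.
move=> X2 NX; set P := \prod_(_ <= _ < _ | _) _; have /andP[N0 NX'] := NX.
pose t n : R :=
  \prod_(0 <= p < n | prime p && ~~ (p %| N)%N) K_ndvd_factor R N p.
pose D : R := \prod_(p <- primes N) local_factor R N p.
have KE : Kstar R N = limn t * D.
  rewrite /Kstar /K natr_div_totient // -mulrA -big_split /=; congr (_ * _).
  rewrite /D big_seq [RHS]big_seq; apply: eq_bigr => p.
  by rewrite mem_primes /local_factor => /and3P[_ _ ->].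
have D0 : 0 <= D.
  rewrite /D big_seq; apply: prodr_ge0 => p.
  rewrite mem_primes => /and3P[pp _ _]; exact: local_factor_ge0.
have PE : P = t X.+1 * D.
  rewrite /P (bigID (fun p => (p %| N)%N)) /= mulrC /D.
  rewrite (@prod_primes _ _ _ X.+1) //.
  congr (_ * _); apply: eq_bigr => p /andP[_ ndp].
  by rewrite /local_factor (negbTE ndp).
have t0 n : 0 <= t n.
  apply: prodr_ge0 => p /andP[pp ndp].
  by have := local_factor_ge0 R p N pp N0; rewrite /local_factor (negbTE ndp).
have tE d : t (d + X.+1)%N = t X.+1 *
    \prod_(X.+1 <= p < (X.+1 + d) | prime p && ~~ (p %| N)%N)
      K_ndvd_factor R N p.
  by rewrite addnC /t (big_cat_nat (leq0n X.+1)) // leq_addr.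
have tb d : (1 - X%:R^-1) * t X.+1 <= t (d + X.+1)%N <= t X.+1.
  rewrite tE; set T := \prod_(_ <= _ < _ | _) _.
  have /andP[h1 h2] : 1 - X%:R^-1 <= T <= 1 by apply: prod_K_ndvd_factor_tail.
  by rewrite mulrC ler_wpM2l //= ler_piMr.
(* [limn] is informative only for a convergent sequence. From [X.+1] on, [t] is nonincreasing, its
   new factors being at most 1, and it is bounded below by [tb]. *)
have cv : cvgn t.
  have : cvgn (fun d => t (d + X.+1)%N).
    apply: nonincreasing_is_cvgn; last first.
      by exists ((1 - X%:R^-1) * t X.+1) => _ [d _ <-]; have /andP[] := tb d.
    apply/nonincreasing_seqP => d; rewrite addSn /t big_mkcond big_nat_recr //=.
    rewrite -big_mkcond /= ler_piMr //.
      exact: t0.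
    case: ifP => // _; have k2 : (2 <= d + X.+1)%N by lia.
    by have /andP[] := K_ndvd_factor_bounds R N (d + X.+1) k2.
  by case/cvg_ex => l; rewrite cvg_shiftn => tl; apply/cvg_ex; exists l.
have lb : (1 - X%:R^-1) * t X.+1 <= limn t.
  apply: limr_ge => //; exists X.+1 => // n /= Xn.
  by have /andP[] := tb (n - X.+1)%N; rewrite subnK.
have ub : limn t <= t X.+1.
  apply: limr_le => //; exists X.+1 => // n /= Xn.
  by have /andP[] := tb (n - X.+1)%N; rewrite subnK.
by rewrite KE PE mulrA !ler_wpM2r.
Qed.

(** * Summation over all [N] and over odd [N] *)

Lemma sum_Kstar_sub_prod (R : realType) (Q : pred nat) (X : nat) :
    (2 <= X)%N ->
  `|\sum_(1 <= N < X.+1 | Q N) Kstar R N - \sum_(1 <= N < X.+1 | Q N)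
      \prod_(0 <= p < X.+1 | prime p) local_factor R N p| <=
  X%:R^-1 * \sum_(1 <= N < X.+1 | Q N)
    \prod_(0 <= p < X.+1 | prime p) local_factor R N p.
Proof.
move=> X2; rewrite -sumrB mulr_sumr.
apply: le_trans (ler_norm_sum _ _ _) _.
rewrite big_nat_cond [leRHS]big_nat_cond; apply: ler_sum => N.
case/andP=> /andP[N0 NX] _.
have /andP[lb ub] : (1 - X%:R^-1) *
    \prod_(0 <= p < X.+1 | prime p) local_factor R N p <= Kstar R N <=
    \prod_(0 <= p < X.+1 | prime p) local_factor R N p.
  by apply: Kstar_bounds; rewrite ?N0.
by rewrite ler0_norm ?subr_le0 //; lra.
Qed.

Lemma sum_prod_local_factor_le (R : realType) (X : nat) :
  `|\sum_(1 <= N < X.+1) \prod_(0 <= p < X.+1 | prime p) local_factor R N p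
    - X%:R| <= \prod_(0 <= p < X.+1 | prime p) err_factor R p.
Proof.
pose s := [seq p <- index_iota 0 X.+1 | prime p].
have -> : \sum_(1 <= N < X.+1)
      \prod_(0 <= p < X.+1 | prime p) local_factor R N p =
    \sum_(1 <= N < X.+1 | N == 0 %[mod 1]) \prod_(p <- s) local_factor R N p.
  by apply: eq_big => N; rewrite ?modn1 // big_filter.
rewrite -[X in _ - X]divr1 -[leRHS]big_filter.
apply: sum_prod_local_factor; rewrite ?filter_uniq ?iota_uniq ?filter_all //.
by apply/allP => p _; apply: coprime1n.
Qed.

Lemma sum_odd_prod_local_factor_le (R : realType) (X : nat) : (2 <= X)%N ->
  `|\sum_(1 <= N < X.+1 | odd N)
      \prod_(0 <= p < X.+1 | prime p) local_factor R N p - X%:R / 3| <=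
  \prod_(0 <= p < X.+1 | prime p) err_factor R p.
Proof.
move=> X2; pose s := [seq p <- index_iota 0 X.+1 | prime p].
have us : uniq s by rewrite filter_uniq ?iota_uniq.
have s2 : 2%N \in s by rewrite mem_filter mem_index_iota ltnS X2.
have ps : all prime s by apply: filter_all.
pose r := rem 2%N s.
have pr : all prime r by apply/allP => p /mem_rem; apply: (allP ps).
have cr : all (coprime 2) r.
  apply/allP => p rp; have pp := allP pr p rp.
  move: rp; rewrite prime_coprime // dvdn_prime2 // mem_rem_uniq // !inE.
  by rewrite eq_sym => /andP[].
have sE (F : nat -> R) :
    \prod_(0 <= p < X.+1 | prime p) F p = F 2%N * \prod_(p <- r) F p.
  by rewrite -big_filter (big_rem 2%N).
have f2 (N : nat) : odd N -> local_factor R N 2 = 2 / 3.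
  move=> oN; rewrite /local_factor /K_ndvd_factor kronecker_sqr dvdz_predn.
  by rewrite dvdn2 oN /= modn2 oN /=; field.
have e2 : err_factor R 2 = 8 / 3 by rewrite /err_factor; field.
have := @sum_prod_local_factor R r 2 1 X (rem_uniq _ us) pr isT cr.
rewrite sE e2.
set E := \prod_(_ <- r) err_factor R _ => H.
have -> : \sum_(1 <= N < X.+1 | odd N)
      \prod_(0 <= p < X.+1 | prime p) local_factor R N p =
    2 / 3 * \sum_(1 <= N < X.+1 | N == 1 %[mod 2])
      \prod_(p <- r) local_factor R N p.
  rewrite mulr_sumr; apply: eq_big => [N|N oN]; first by rewrite modn2 eqb1.
  by rewrite sE f2.
(* The main term is [2/3 * X/2 = X/3], and the error [2/3 * E] is below [8/3 * E]. *)
move: H; rewrite !ler_norml => /andP[h1 h2].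
by apply/andP; split; lra.
Qed.

(** The constant [c] is the mean of [Kstar] restricted to [Q]: 1 for all [N], [1/3] for odd [N]. *)
Lemma sum_Kstar_le (R : realType) (Q : pred nat) (c x : R) :
    0 <= c <= 1 -> 2 <= x ->
  (forall X : nat, (2 <= X)%N ->
    `|\sum_(1 <= N < X.+1 | Q N)
        \prod_(0 <= p < X.+1 | prime p) local_factor R N p - c * X%:R| <=
    \prod_(0 <= p < X.+1 | prime p) err_factor R p) ->
  `|\sum_(1 <= N < (Num.truncn x).+1 | Q N) Kstar R N - c * x| <=
    44 * (x / ln x).
Proof.
move=> /andP[c0 c1] x2 HQ; set X := Num.truncn x.
have /andP[Xx xX] : X%:R <= x < X.+1%:R by apply: truncn_itv; lra.
have X2 : (2 <= X)%N by rewrite /X truncn_ge_nat //; lra.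
have := sum_Kstar_sub_prod R Q X X2; have := HQ X X2.
have := prod_err_factor_le R X x x2 X2 Xx.
set E := \prod_(_ <= p < _ | _) err_factor R p.
set S := \sum_(_ <= N < _ | _) \prod_(_ <= _ < _ | _) _.
set T := \sum_(_ <= N < _ | _) _ => HE HS HT.
have E1 : 1 <= E.
  rewrite /E; elim/big_ind: _ => [//|a b a1 b1|p]; first by rewrite mulr_ege1.
  exact: err_factor_ge1.
have X2R : 2 <= X%:R :> R by rewrite ler_nat.
have i0 : 0 <= X%:R^-1 :> R by rewrite invr_ge0.
have i1 : X%:R^-1 <= 1 :> R by rewrite invf_le1; lra.
have iS : X%:R^-1 * S <= 1 + E.
  have : S <= X%:R + E by move: HS; rewrite ler_norml => /andP[_]; nra.
  move=> /(ler_wpM2l i0) /le_trans; apply.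
  rewrite mulrDr mulVf; last by apply/eqP; lra.
  by rewrite lerD2l ler_piMl //; lra.
move: xX; rewrite -natr1 => xX.
have cx : `|c * X%:R - c * x| <= 1.
  rewrite -mulrBr normrM ger0_norm // ler0_norm; last by lra.
  by rewrite mulr_ile1 //; lra.
(* The three parts are at most [1 + E], [E] and [1]; as [E >= 1], the total is at most [4 * E], and
   [E <= 11 * (x / ln x)] gives 44. *)
have -> : T - c * x = (T - S) + (S - c * X%:R) + (c * X%:R - c * x) by ring.
apply: le_trans (ler_normD _ _) _.
apply: le_trans (lerD (ler_normD _ _) (lexx _)) _.
lra.
Qed.

Theorem theorem1p2 (R : realType) :
  (exists C : R, forall x : R, 2 <= x ->
     `| (\sum_(1 <= N < (Num.truncn x).+1) Kstar R N) - x |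
       <= C * (x / ln x)) /\
  (exists C : R, forall x : R, 2 <= x ->
     `| (\sum_(1 <= N < (Num.truncn x).+1 | odd N) Kstar R N) - x / 3 |
       <= C * (x / ln x)).
Proof.
split; exists 44 => x x2.
  rewrite -[X in _ - X]mul1r; apply: sum_Kstar_le => //.
    by rewrite ler01 lexx.
  by move=> X _; rewrite mul1r; apply: sum_prod_local_factor_le.
rewrite [x / 3]mulrC; apply: sum_Kstar_le => //.
  by apply/andP; split; lra.
by move=> X X2; rewrite [_^-1 * _]mulrC; apply: sum_odd_prod_local_factor_le.
Qed.
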